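(* For each integer $r\ge2$ and $n\ge1$, let $Y^{(r)}=\max_{1\le k\le rn}X^{(r)}_k$. For every integer $r\ge2$ there exists a constant $C>0$ such that $$\lim_{n\to\infty}\mathbb{P}\left(\left|Y^{(r)}-\frac{(r-1)n}{r^{\frac1{r-1}}}\right|\le C\sqrt{n\log n}\right)=1.$$
   Context: $[m]=\{1,2,\dots,m\}$. An $r$-matching on $[rn]$ is a partition of $[rn]$ into $n$ subsets of size $r$, called edges. There are $\frac{(rn)!}{(r!)^n n!}$ of them. For an $r$-matching $M$ on $[rn]$ and $k\in[rn]$, let $M_k$ be the set of all edges of $M$ having nonempty intersection with both $[k]$ and $[rn]\setminus[k]$, and let $x_k(M)=\sum_{e\in M_k}|e\cap[k]|$. Let $\mathbf{M}^{(r)}_n$ be an $r$-matching chosen uniformly at random from all $r$-matchings on $[rn]$, and let $X^{(r)}_k=x_k(\mathbf{M}^{(r)}_n)$ for $k\in[rn]$. *)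

(* Defs.v *)
From mathcomp Require Import all_boot all_order all_algebra.

Set Implicit Arguments.
Unset Strict Implicit.
Unset Printing Implicit Defensive.

Import GRing.Theory Num.Theory.

(* The ground set {1, ..., m} is encoded as 'I_m, the ordinal i standing for
   the integer i + 1; hence the initial segment {1, ..., k} consists of the
   ordinals i < k. *)
Definition segment (m k : nat) : {set 'I_m} := [set i : 'I_m | i < k].

Definition matchings (r n : nat) : {set {set {set 'I_(r * n)}}} :=
  [set M : {set {set 'I_(r * n)}} |
    [&& partition M [set: 'I_(r * n)], #|M| == n
      & [forall e in M, #|e| == r]]].

Definition crossing_edges (m k : nat) (M : {set {set 'I_m}}) :
    {set {set 'I_m}} :=
  [set e in M | (e :&: segment m k != set0) && (e :&: ~: segment m k != set0)].

Definition crossing_weight (m k : nat) (M : {set {set 'I_m}}) : nat :=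
  \sum_(e in crossing_edges k M) #|e :&: segment m k|.

Definition max_crossing_weight (m : nat) (M : {set {set 'I_m}}) : nat :=
  \max_(1 <= k < m.+1) crossing_weight k M.

Local Open Scope ring_scope.

(* Probability of the event E for an element chosen uniformly at random
   from the finite set A; it is 0 when A is empty. *)
Definition uniform_pr (R : realFieldType) (T : finType) (A : {set T})
    (E : pred T) : R :=
  #|[set x in A | E x]|%:R / #|A|%:R.

(* Main.v *)
(** Let [N_k] be the number of edges of the matching contained in [[k]].  The
    edges that do not cross contribute [r N_k] to [k], so [X_k = k - r N_k].
    By symmetry the law of [N_k] is that of the number of edges of a fixed
    matching contained in a uniformly random [k]-subset [S] of the [m = rn]
    points.  If [S] is sampled instead by keeping each point independently with
    probability [p = k / m], this number is exactly binomial with parameters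
    [n] and [p ^ r]; since [k] is the mode of [|S|], the event [|S| = k] has
    probability at least [1 / (m + 1)], so passing to the uniform [k]-subset
    costs only a factor [m + 1] in a Chernoff bound.  A union bound over [k]
    gives [N_k = n (k / m) ^ r + O(sqrt (n log n))] for all [k] simultaneously,
    and [m (y - y ^ r)] is maximal, with value [(r - 1) n x], at the [x] such
    that [r x ^ (r - 1) = 1]. *)
Require Import Defs.
From mathcomp Require Import all_boot all_order all_algebra all_fingroup.
From mathcomp Require Import all_classical all_reals all_analysis.
From mathcomp Require Import fintype finset lra zify ring.
Import GRing.Theory Num.Theory Order.TTheory numFieldNormedType.Exports.
Local Open Scope ring_scope.

(** * Bernoulli random subsets and the generating function of the number of contained edges *)

Definition inside_edges {T : finType} (M : {set {set T}}) (S : {set T}) :=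
  [set e in M | e \subset S].

Definition bernoulli_weight {R : pzRingType} {T : finType} (p : R)
    (S : {set T}) : R :=
  p ^+ #|S| * (1 - p) ^+ #|~: S|.

(** A point of [A] contributes the factor [p], any other point [p + (1 - p) = 1]. Expanding this
    product over all points gives one term per [S], which vanishes unless [S] contains [A]. *)
Lemma sum_bernoulli_weight_superset (R : comPzRingType) (T : finType) (p : R)
    (A : {set T}) :
  \sum_(S : {set T} | A \subset S) bernoulli_weight p S = p ^+ #|A|.
Proof.
have -> : p ^+ #|A| = \prod_(i : T) (p + (1 - p) *+ (i \notin A)).
  apply/esym; rewrite (bigID (mem A)) /= -[RHS]mulr1 -prodr_const; congr (_ * _).
    by apply: eq_bigr => i ->; rewrite mulr0n addr0.
  by rewrite big1 // => i ->; rewrite mulr1n; ring.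
rewrite bigA_distr big_mkcond; apply: eq_bigr => S _ /=.
case: ifPn => [/subsetP AS|/subsetPn[x xA xS]]; last first.
  by rewrite (bigD1 x) //= (negPf xS) xA mulr0n mul0r.
rewrite (bigID (mem S)) /= /bernoulli_weight -!prodr_const; congr (_ * _).
  by apply: eq_bigr => i ->.
rewrite [LHS](eq_bigl (fun i => i \notin S)) => [|i]; last by rewrite inE.
apply: eq_bigr => i iS; rewrite (negPf iS).
by rewrite (contra (AS i) iS) mulr1n.
Qed.

Lemma prod_1D (R : comPzRingType) (I : finType) (A : {set I}) (F : I -> R) :
  \prod_(i in A) (1 + F i) = \sum_(J : {set I} | J \subset A) \prod_(i in J) F i.
Proof.
rewrite big_mkcond /=.
rewrite (eq_bigr (fun i => (if i \in A then F i else 0) + 1)); last first.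
  by move=> i _; case: ifP; rewrite 1?addrC ?addr0 ?add0r.
rewrite bigA_distr [RHS]big_mkcond; apply: eq_bigr => J _ /=.
rewrite -big_mkcond /=; case: ifPn => [/subsetP JA|/subsetPn[x xJ xA]].
  by apply: eq_bigr => i /JA ->.
by rewrite (bigD1 x) //= (negPf xA) mul0r.
Qed.

(** Writing [z = 1 + (z - 1)] expands the power of [z] over sets [J] of contained edges. After
    exchanging the sums, [J] carries [(z - 1) ^+ #|J|] times the mass of the sets containing
    [cover J], which has [r * #|J|] points by disjointness. The result is the generating function of
    a binomial law. *)
Lemma sum_bernoulli_weight_expr (R : comPzRingType) (T : finType) (p z : R)
    (r : nat) (M : {set {set T}}) :
  trivIset M -> {in M, forall e : {set T}, #|e| = r} ->
  \sum_(S : {set T}) bernoulli_weight p S * z ^+ #|inside_edges M S|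
  = (1 + (z - 1) * p ^+ r) ^+ #|M|.
Proof.
move=> trivM cardM.
have prodE (J : {set {set T}}) (c : R) : \prod_(e in J) c = c ^+ #|J|.
  by rewrite prodr_const.
rewrite -prodE prod_1D.
under eq_bigr => S _.
  rewrite -prodE.
  rewrite (eq_bigr (fun=> 1 + (z - 1))); last by move=> *; ring.
  rewrite prod_1D mulr_sumr.
  over.
rewrite (exchange_big_dep (fun J : {set {set T}} => J \subset M)) /=; last first.
  move=> S J _ /subset_trans; apply; apply/subsetP => e.
  by rewrite !inE => /andP[].
apply: eq_bigr => J JM.
have trivJ : trivIset J by apply: trivIsetS trivM.
have cardJ : #|cover J| = (r * #|J|)%N.
  rewrite -(eqP trivJ) (eq_bigr (fun=> r)).
    by rewrite sum_nat_const mulnC.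
  by move=> e eJ; rewrite cardM //; apply: (subsetP JM).
rewrite !prodE exprMn -exprM -cardJ -(sum_bernoulli_weight_superset R T p) mulr_sumr.
apply: eq_big => [S|S _]; last by rewrite mulrC.
apply/subsetP/subsetP => [h x /bigcupP[e eJ xe]|h e eJ].
  by have := h e eJ; rewrite !inE => /andP[_ /subsetP]; apply.
rewrite !inE (subsetP JM) //=; apply/subsetP => x xe.
by apply: h; apply/bigcupP; exists e.
Qed.

(** * Probability that the random subset has exactly k points *)

Lemma sum_bernoulli_weight (R : comPzRingType) (T : finType) (p : R) :
  \sum_(S : {set T}) bernoulli_weight p S = 1.
Proof.
have := sum_bernoulli_weight_superset R T p set0.
by rewrite cards0 expr0 => <-; apply: eq_bigl => S; rewrite sub0set.
Qed.

(* The mode of the binomial law with parameters m and k / m, denominators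
   cleared. *)
Lemma binomial_mode (m k j : nat) : (k <= m)%N -> (j <= m)%N ->
  ('C(m, j) * k ^ j * (m - k) ^ (m - j) <=
   'C(m, k) * k ^ k * (m - k) ^ (m - k))%N.
Proof.
set a := fun j => ('C(m, j) * k ^ j * (m - k) ^ (m - j))%N.
(* For [k = m] all terms with [j < m] vanish. This case is split off because the ratio argument
   below cancels [m - k]. *)
rewrite leq_eqVlt => /predU1P[->|km] jm.
  have [->|jm'] := eqVneq j m; first by [].
  by rewrite subnn exp0n ?muln0 // subn_gt0 ltn_neqAle jm'.
(* Ratio of consecutive terms, cross-multiplied: comparing [i.+1 * (m - k)] with [(m - i) * k] shows
   that [a] rises up to [k] and falls afterwards. *)
have recur i : (i < m)%N -> (a i.+1 * (i.+1 * (m - k)) = a i * ((m - i) * k))%N.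
  move=> im; rewrite /a -(subnSK im) !expnS.
  have := mul_bin_left m i; rewrite -(subnSK im) => h.
  transitivity ((i.+1 * 'C(m, i.+1)) * (k * k ^ i) *
    ((m - k) ^ (m - i.+1) * (m - k)))%N; first by ring.
  by rewrite h; ring.
have up i : (i < k)%N -> (a i <= a i.+1)%N.
  move=> ik; have im : (i < m)%N by lia.
  have pos : (0 < i.+1 * (m - k))%N by nia.
  rewrite -(leq_pmul2r pos) recur // leq_mul2l; apply/orP; right; nia.
have down i : (k <= i)%N -> (i < m)%N -> (a i.+1 <= a i)%N.
  move=> ik im.
  have pos : (0 < i.+1 * (m - k))%N by nia.
  rewrite -(leq_pmul2r pos) recur // leq_mul2l; apply/orP; right; nia.
rewrite -/(a j) -/(a k); have [jk|kj] := leqP j k.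
  rewrite -(subKn jk); elim: (k - j)%N (leq_subr j k) => [|d IH] dk.
    by rewrite subn0.
  apply: leq_trans (IH _); last by lia.
  have -> : (k - d)%N = (k - d.+1).+1 by lia.
  by apply: up; lia.
rewrite -(subnKC (ltnW kj)) in jm *; elim: (j - k)%N jm => [|d IH] dk.
  by rewrite addn0.
apply: leq_trans (IH _); last by lia.
by rewrite addnS; apply: down; lia.
Qed.

Lemma bernoulli_weight_card (R : pzRingType) (T : finType) (p : R) (k : nat)
    (S : {set T}) :
  #|S| = k -> bernoulli_weight p S = p ^+ k * (1 - p) ^+ (#|T| - k).
Proof. by move=> Sk; rewrite /bernoulli_weight Sk cardsCs setCK Sk. Qed.

Lemma sum_bernoulli_weight_card (R : comPzRingType) (T : finType) (p : R)
    (k : nat) :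
  \sum_(S : {set T} | #|S| == k) bernoulli_weight p S =
  'C(#|T|, k)%:R * (p ^+ k * (1 - p) ^+ (#|T| - k)).
Proof.
rewrite (eq_bigr (fun=> p ^+ k * (1 - p) ^+ (#|T| - k))); last first.
  by move=> S /eqP; apply: bernoulli_weight_card.
rewrite sumr_const mulr_natl -cardsT -cards_draws; congr (_ *+ _).
by apply: eq_card => S; rewrite !inE unfold_in /= subsetT.
Qed.

(** The total mass 1 splits over the [#|T|.+1] possible sizes, and no size is heavier than the mode
    [k]. *)
Lemma bernoulli_weight_mode_ge (R : realFieldType) (T : finType) (k : nat) :
  (k <= #|T|)%N -> (0 < #|T|)%N ->
  1 <= #|T|.+1%:R *
    \sum_(S : {set T} | #|S| == k) bernoulli_weight (k%:R / #|T|%:R : R) S.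
Proof.
move=> km m0; set p : R := k%:R / _; set m := #|T| in km m0 p *.
have m0' : (m%:R : R) != 0 by rewrite pnatr_eq0 -lt0n.
rewrite -[X in X <= _](sum_bernoulli_weight R T p).
rewrite (partition_big (fun S : {set T} => inord #|S| : 'I_m.+1) predT) //=.
rewrite mulr_natl -[X in _ *+ X]card_ord -sumr_const.
apply: ler_sum => j _.
have sumE i : (i <= m)%N ->
  \sum_(S : {set T} | #|S| == i) bernoulli_weight p S =
  ('C(m, i) * k ^ i * (m - k) ^ (m - i))%:R / m%:R ^+ m.
  move=> im; rewrite sum_bernoulli_weight_card -/m.
  have -> : 1 - p = (m - k)%:R / m%:R by rewrite natrB // /p; field.
  rewrite /p !expr_div_n !natrM !natrX -[X in _ / _ ^+ X](subnKC im) exprD.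
  by field; rewrite !expf_neq0.
rewrite (eq_bigl (fun S : {set T} => #|S| == j)); last first.
  by move=> S; rewrite -val_eqE /= inordK // ltnS max_card.
have jm : (j <= m)%N by rewrite -ltnS.
rewrite (sumE _ jm) (sumE _ km) ler_pM2r ?invr_gt0 ?exprn_gt0 ?ltr0n // ler_nat.
exact: binomial_mode.
Qed.

(** * Symmetry of matchings under permutations of the points, and their existence *)

(** Induction on [#|A :\: B|]: transposing a point of [A :\: B] with a point of [B :\: A] lowers it
    by one and keeps [#|A|]. *)
Lemma ex_perm_imset (T : finType) (A B : {set T}) :
  #|A| = #|B| -> exists s : {perm T}, [set s x | x in A] = B.
Proof.
move: {2}#|A :\: B| (erefl #|A :\: B|) => d.
elim: d A => [|d IH] A dE cardAB.
  exists 1%g; have sAB : A \subset B by rewrite -setD_eq0 -cards_eq0 dE.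
  rewrite (eq_imset _ (@perm1 T)) imset_id.
  by apply/eqP; rewrite eqEcard sAB cardAB leqnn.
have /card_gt0P[x] : (0 < #|A :\: B|)%N by rewrite dE.
rewrite inE => /andP[xB xA].
have /card_gt0P[y] : (0 < #|B :\: A|)%N.
  by have := cardsID B A; have := cardsID A B; rewrite setIC; lia.
rewrite inE => /andP[yA yB].
have xy : x != y by apply: contraNneq xB => ->.
pose A' := [set tperm x y z | z in A].
have A'E : A' :\: B = (A :\: B) :\ x.
  apply/setP => z; rewrite !inE.
  have -> : (z \in A') = (tperm x y z \in A).
    by rewrite -{1}[z](tpermK x y) mem_imset //; apply: perm_inj.
  case: tpermP => [->|->|/eqP -> _] //.
  - by rewrite (negPf yA) eqxx andbF.
  - by rewrite yB !andbF.
have [||s sE] := IH A'.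
- by have := cardsD1 x (A :\: B); rewrite A'E inE xB xA dE; case.
- by rewrite card_imset //; apply: perm_inj.
exists (tperm x y * s)%g; rewrite -sE /A' -imset_comp.
by apply: eq_imset => z; rewrite permM.
Qed.

Lemma matchingsP (r n : nat) (M : {set {set 'I_(r * n)}}) :
  reflect [/\ partition M [set: 'I_(r * n)], #|M| = n
            & {in M, forall e : {set 'I_(r * n)}, #|e| = r}]
          (M \in matchings r n).
Proof.
rewrite inE; apply: (iffP and3P) => -[pM nM rM]; split=> //.
- exact/eqP.
- by move=> e eM; apply/eqP/(forall_inP rM).
- exact/eqP.
- by apply/forall_inP => e eM; apply/eqP/rM.
Qed.

Lemma imset_matchings (r n : nat) (s : {perm 'I_(r * n)})
    (M : {set {set 'I_(r * n)}}) :
  M \in matchings r n ->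
  [set [set s x | x in e : {set 'I_(r * n)}] | e in M] \in matchings r n.
Proof.
move=> /matchingsP[pM nM rM]; apply/matchingsP; split.
- have -> : [set: 'I_(r * n)] = [set s x | x in [set: 'I_(r * n)]].
    by apply/esym/eqP; rewrite eqEcard subsetT card_imset ?leqnn //; apply: perm_inj.
  by rewrite imset_partition //; apply: perm_inj.
- by rewrite card_imset //; apply/imset_inj/perm_inj.
- by move=> _ /imsetP[e eM ->]; rewrite card_imset ?rM //; apply: perm_inj.
Qed.

Lemma card_inside_edges_imset (T : finType) (s : {perm T}) (M : {set {set T}})
    (S : {set T}) :
  #|inside_edges [set [set s x | x in e : {set T}] | e in M] [set s x | x in S]|
  = #|inside_edges M S|.
Proof.
have sI := @perm_inj _ s.
rewrite -(card_imset (inside_edges M S) (imset_inj sI)).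
congr #|pred_of_set _|; apply/setP => f; apply/idP/imsetP.
  rewrite inE => /andP[/imsetP[e eM ->]].
  move=> /subsetP eS; exists e => //; rewrite inE eM; apply/subsetP => x xe.
  by rewrite -(mem_imset _ _ sI) eS // imset_f.
by move=> [e]; rewrite inE => /andP[eM eS] ->; rewrite inE imsetS // andbT imset_f.
Qed.

(** A permutation carrying [S] to [S'] acts injectively on matchings and preserves the count of
    contained edges. This gives one inequality; exchanging the two sets gives the other. *)
Lemma card_matchings_inside (r n : nat) (Q : pred nat) (S S' : {set 'I_(r * n)}) :
  #|S| = #|S'| ->
  #|[set M in matchings r n | Q #|inside_edges M S| ]| =
  #|[set M in matchings r n | Q #|inside_edges M S'| ]|.
Proof.
suff le (A B : {set 'I_(r * n)}) : #|A| = #|B| ->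
    (#|[set M in matchings r n | Q #|inside_edges M A| ]| <=
     #|[set M in matchings r n | Q #|inside_edges M B| ]|)%N.
  by move=> SS'; apply/eqP; rewrite eqn_leq !le.
move=> /ex_perm_imset[s <-].
have tI := imset_inj (imset_inj (@perm_inj _ s)).
rewrite -(card_imset _ tI); apply/subset_leq_card/subsetP => N /imsetP[M + ->].
rewrite inE => /andP[MM QM].
by rewrite inE imset_matchings //= card_inside_edges_imset.
Qed.

(** Makes the denominator of [uniform_pr] nonzero. The bijection [mxvec_index] from pairs to points
    yields [n] blocks of size [r], nonempty because [r] is positive. *)
Lemma matchings_gt0 (r n : nat) : (0 < r)%N -> (0 < #|matchings r n|)%N.
Proof.
move=> r0; pose B (i : 'I_n) := [set mxvec_index j i | j : 'I_r].
have mI (j j' : 'I_r) (i i' : 'I_n) :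
    mxvec_index j i = mxvec_index j' i' -> (j, i) = (j', i').
  have [g gK _] := curry_mxvec_bij r n.
  by move=> e; have /= <- := gK (j, i) isT; have /= <- := gK (j', i') isT; rewrite e.
have [||pB BI] := @indexed_partition 'I_n _ 'I_n B.
- move=> i i' _ _ ii'; rewrite -setI_eq0; apply/eqP/setP => x; rewrite !inE.
  apply/negP => /andP[/imsetP[j _ ->] /imsetP[j' _ /mI[_ ei]]].
  by rewrite ei eqxx in ii'.
- by move=> i _; apply/set0Pn; exists (mxvec_index (Ordinal r0) i); apply: imset_f.
set P := [set B i | i in 'I_n] in pB.
apply/card_gt0P; exists P; apply/matchingsP; split.
- suff <- : cover P = [set: 'I_(r * n)] by [].
  apply/setP => x; rewrite inE; case/mxvec_indexP: x => j i.
  by apply/bigcupP; exists (B i); apply: imset_f.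
- by rewrite card_in_imset // card_ord.
- move=> _ /imsetP[i _ ->]; rewrite card_imset ?card_ord //.
  by move=> j j' /mI[].
Qed.

(** * Crossing weight in terms of contained edges *)

Lemma card_segment (m k : nat) : (k <= m)%N -> #|segment m k| = k.
Proof.
move=> km; rewrite -sum1_card (eq_bigl (fun i : 'I_m => i < k)%N) => [|i].
  by rewrite -(big_ord_widen m (fun=> 1%N) km) sum1_card card_ord.
by rewrite inE.
Qed.

(** Each point of the segment lies in exactly one edge. Edges inside the segment cover [r] of its
    points each, edges disjoint from it none, and all others cross. The additive form avoids
    truncated subtraction. *)
Lemma crossing_weight_inside (r n k : nat) (M : {set {set 'I_(r * n)}}) :
  M \in matchings r n -> (k <= r * n)%N ->
  (crossing_weight k M + r * #|inside_edges M (segment (r * n) k)|)%N = k.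
Proof.
move=> /matchingsP[pM nM rM] km; set S := segment _ _.
have -> : (r * #|inside_edges M S|)%N = (\sum_(e in inside_edges M S) #|e :&: S|)%N.
  rewrite mulnC -sum_nat_const; apply: eq_bigr => e.
  by rewrite inE => /andP[eM /setIidPl ->]; rewrite rM.
rewrite -[RHS](card_segment _ _ km) -/S.
have -> : #|S| = (\sum_(e in M) #|e :&: S|)%N.
  rewrite -sum1_card.
  rewrite (eq_bigl (fun x => (x \in [set: 'I_(r * n)]) && (x \in S))).
    rewrite (set_partition_big_cond _ pM); apply: eq_bigr => e eM.
    by rewrite -sum1_card; apply: eq_bigl => x; rewrite in_setI.
  by move=> x; rewrite in_setT.
rewrite [RHS](bigID (fun e : {set 'I_(r * n)} => e \subset S)) addnC /=.
congr (_ + _)%N; first by apply: eq_bigl => e; rewrite inE.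
rewrite [RHS](bigID (fun e : {set 'I_(r * n)} => e :&: S != set0)) /=.
rewrite [X in (_ + X)%N]big1 ?addn0 => [|e /andP[_]]; last first.
  by rewrite negbK => /eqP ->; rewrite cards0.
apply: eq_bigl => e; rewrite inE -setDE setD_eq0.
by case: (e \in M); rewrite //= andbC.
Qed.

(** * Chernoff bound for random subsets and its transfer to random matchings *)

(** Combines [expR x <= (1 - x)^-1] with [(1 + x + 2 * x ^+ 2) * (1 - x) - 1 = x ^+ 2 * (1 - 2 *
    x)]. Negative [x] is allowed, which serves the lower tail. *)
Lemma expR_le_1D (R : realType) (x : R) : x <= 1 / 2 ->
  expR x <= 1 + x + 2 * x ^+ 2.
Proof.
move=> x2; have x1 : 0 < 1 - x by lra.
have h : 1 - x <= expR (- x) by apply: expR_ge1Dx.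
rewrite -[x in expR x]opprK expRN.
apply: (@le_trans _ _ (1 - x)^-1).
  by rewrite lef_pV2 // ?posrE ?expR_gt0.
rewrite -[leLHS]mul1r ler_pdivrMr //.
have : 0 <= x ^+ 2 * (1 - 2 * x) by rewrite mulr_ge0 ?sqr_ge0 //; lra.
by lra.
Qed.

Lemma bernoulli_weight_ge0 (R : realFieldType) (T : finType) (p : R)
    (S : {set T}) :
  0 <= p <= 1 -> 0 <= bernoulli_weight p S.
Proof.
by move=> /andP[p0 p1]; rewrite mulr_ge0 ?exprn_ge0 // subr_ge0.
Qed.

(** By the generating function at [z = expR l], each edge contributes [1 + (expR l - 1) * q <= expR
    (q * l + 2 * l ^+ 2)]; centring cancels the linear term. *)
Lemma bernoulli_expectation_expR (R : realType) (T : finType) (p : R) (r : nat)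
    (M : {set {set T}}) (l : R) :
  trivIset M -> {in M, forall e : {set T}, #|e| = r} -> 0 <= p <= 1 -> l <= 1 / 2 ->
  \sum_(S : {set T}) bernoulli_weight p S *
      expR (l * (#|inside_edges M S|%:R - #|M|%:R * p ^+ r))
  <= expR (2 * l ^+ 2 * #|M|%:R).
Proof.
move=> trivM cardM p01 l2; set n : R := #|M|%:R; set q := p ^+ r.
have /andP[q0 q1] : 0 <= q <= 1.
  by case/andP: p01 => p0 p1; rewrite exprn_ge0 ?exprn_ile1.
rewrite (eq_bigr (fun S => bernoulli_weight p S *
    expR l ^+ #|inside_edges M S| * expR (- (l * n * q)))); last first.
  move=> S _; rewrite -mulrA -expRM_natl -expRD; congr (_ * expR _); ring.
rewrite -mulr_suml (sum_bernoulli_weight_expr R T p (expR l) r) // -/q.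
have step : 1 + (expR l - 1) * q <= expR (q * l + 2 * l ^+ 2).
  apply: le_trans (expR_ge1Dx _).
  have h := expR_le_1D R l l2.
  have : (expR l - 1) * q <= (l + 2 * l ^+ 2) * q by rewrite ler_wpM2r //; lra.
  have : 2 * l ^+ 2 * q <= 2 * l ^+ 2.
    by rewrite ler_piMr // mulr_ge0 ?sqr_ge0.
  by lra.
have base0 : 0 <= 1 + (expR l - 1) * q.
  have := mulr_ge0 (expR_ge0 l) q0; lra.
apply: (@le_trans _ _ (expR (q * l + 2 * l ^+ 2) ^+ #|M| * expR (- (l * n * q)))).
  by rewrite ler_wpM2r ?expR_ge0 // lerXn2r // nnegrE expR_ge0.
rewrite -expRM_natl -expRD -/n le_eqVlt; apply/orP; left; apply/eqP.
congr expR; ring.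
Qed.

(** Exponential Markov inequality for both tails at once: on the event, [expR (l * D S)] or
    [expR (- l * D S)] is at least [expR (l * t)]. *)
Lemma bernoulli_tail (R : realType) (T : finType) (p : R) (r : nat)
    (M : {set {set T}}) (l t : R) :
  trivIset M -> {in M, forall e : {set T}, #|e| = r} -> 0 <= p <= 1 ->
  0 <= l <= 1 / 2 ->
  \sum_(S : {set T} | t < `|#|inside_edges M S|%:R - #|M|%:R * p ^+ r|)
     bernoulli_weight p S
  <= 2 * expR (2 * l ^+ 2 * #|M|%:R - l * t).
Proof.
move=> trivM cardM p01 /andP[l0 l2].
pose D S : R := #|inside_edges M S|%:R - #|M|%:R * p ^+ r.
have wge0 S : 0 <= bernoulli_weight p S by apply: bernoulli_weight_ge0.
apply: (@le_trans _ _ (\sum_(S : {set T})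
   (bernoulli_weight p S * expR (l * D S) +
    bernoulli_weight p S * expR (- l * D S)) * expR (- (l * t)))).
  rewrite big_mkcond; apply: ler_sum => S _; rewrite -/(D S).
  case: ifPn => [tD|_]; last first.
    by rewrite mulr_ge0 ?expR_ge0 // addr_ge0 // mulr_ge0 ?expR_ge0.
  rewrite -mulrDr -mulrA ler_peMr // mulrDl -!expRD.
  have [D0|D0] := leP 0 (D S).
    rewrite ger0_norm // in tD.
    have : 1 <= expR (l * D S - l * t).
      rewrite -[leLHS]expR0 ler_expR -mulrBr mulr_ge0 // subr_ge0; exact: ltW.
    have := expR_ge0 (- l * D S - l * t); lra.
  rewrite ltr0_norm // in tD.
  have : 1 <= expR (- l * D S - l * t).
    rewrite -[leLHS]expR0 ler_expR mulNr -mulrN -mulrBr mulr_ge0 // subr_ge0.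
    exact: ltW.
  have := expR_ge0 (l * D S - l * t); lra.
rewrite -mulr_suml big_split /= expRD mulrA ler_wpM2r ?expR_ge0 //.
rewrite mulr_natl mulr2n lerD //.
  exact: bernoulli_expectation_expR.
rewrite -[l ^+ 2]sqrrN; apply: bernoulli_expectation_expR => //; lra.
Qed.

(** Double counting of pairs of a bad matching and a [k]-subset, weighted by Bernoulli mass. By
    symmetry every [k]-subset has the same number [b] of bad matchings, so the sum is [b * W]. For a
    fixed matching, dropping the condition on the size bounds its share by the binomial tail.
    Finally [W] is at least the inverse of [(r * n).+1]. *)
Lemma matchings_tail (R : realType) (r n k : nat) (l t : R) :
  (0 < r * n)%N -> (k <= r * n)%N -> 0 <= l <= 1 / 2 ->
  #|[set M in matchings r n |
      t < `|#|inside_edges M (segment (r * n) k)|%:R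
            - n%:R * (k%:R / (r * n)%:R) ^+ r| ]|%:R
  <= #|matchings r n|%:R *
     ((r * n).+1%:R * (2 * expR (2 * l ^+ 2 * n%:R - l * t))) :> R.
Proof.
move=> m0 km l01; set p := k%:R / _.
have p01 : 0 <= p <= 1.
  by rewrite divr_ge0 //= ler_pdivrMr ?ltr0n // mul1r ler_nat.
pose bad (N : nat) := t < `|N%:R - n%:R * p ^+ r|.
pose B S := [set M in matchings r n | bad #|inside_edges M S|].
rewrite -[X in X%:R <= _]/(#|B (segment (r * n) k)|).
set b : R := #|B _|%:R; set E := 2 * expR _.
pose W := \sum_(S : {set 'I_(r * n)} | #|S| == k) bernoulli_weight p S.
have W1 : 1 <= (r * n).+1%:R * W.
  by have := @bernoulli_weight_mode_ge R 'I_(r * n) k; rewrite card_ord; apply.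
have bW : b * W <= #|matchings r n|%:R * E.
  rewrite mulr_sumr (eq_bigr (fun S => \sum_(M in matchings r n)
      if bad #|inside_edges M S| then bernoulli_weight p S else 0)); last first.
    move=> S /eqP Sk; rewrite -big_mkcondr /=.
    rewrite (eq_bigl (mem (B S))) => [|M]; last by rewrite !inE.
    rewrite sumr_const -mulr_natl; congr (_%:R * _).
    by apply: (card_matchings_inside r n bad); rewrite card_segment.
  rewrite exchange_big /= mulr_natl -sumr_const; apply: ler_sum => M.
  move=> /matchingsP[pM nM rM].
  have trivM : trivIset M by case/and3P: pM.
  have := @bernoulli_tail R _ p r M l t trivM rM p01 l01.
  rewrite nM; apply: le_trans.
  rewrite -big_mkcondr /= [leLHS]big_mkcond [leRHS]big_mkcond; apply: ler_sum => S _.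
  rewrite -/(bad _); case: (bad _); rewrite ?andbT ?andbF //.
  by case: ifP => _ //; apply: bernoulli_weight_ge0.
apply: (@le_trans _ _ (b * ((r * n).+1%:R * W))); first by rewrite ler_peMr ?ler0n.
by rewrite mulrCA [leRHS]mulrCA ler_wpM2l ?ler0n.
Qed.

(** * The maximum over k when all deviations are small *)

(** Convexity by induction: multiplying the tangent bound by [y] leaves the surplus
    [n.+1%:R * x ^+ n * (y - x) ^+ 2]. *)
Lemma exprS_ge_tangent (R : realDomainType) (x y : R) (n : nat) :
  0 <= x -> 0 <= y -> x ^+ n.+1 + n.+1%:R * x ^+ n * (y - x) <= y ^+ n.+1.
Proof.
move=> x0 y0; elim: n => [|n IH].
  by rewrite !expr1 expr0 mulr1 mul1r addrC subrK.
rewrite [leRHS]exprS; apply: le_trans (ler_wpM2l y0 IH).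
have h : 0 <= n.+1%:R * x ^+ n * (y - x) ^+ 2.
  by rewrite mulr_ge0 ?sqr_ge0 // mulr_ge0 ?ler0n ?exprn_ge0.
rewrite -subr_ge0; apply: le_trans h _.
rewrite -[n.+2%:R]natr1 !exprS le_eqVlt; apply/orP; left; apply/eqP; ring.
Qed.

Lemma max_crossing_weight_near (R : realType) (r n : nat) (x t : R)
    (M : {set {set 'I_(r * n)}}) :
  (0 < n)%N -> 0 <= x <= 1 -> 1 <= r%:R * x -> r%:R * x ^+ r = x -> 0 <= t ->
  M \in matchings r n ->
  (forall k, (1 <= k < (r * n).+1)%N ->
     `|#|inside_edges M (segment (r * n) k)|%:R
       - n%:R * (k%:R / (r * n)%:R) ^+ r| <= t :> R) ->
  `|(max_crossing_weight M)%:R - (r%:R - 1) * n%:R * x| <= r%:R * t + 1.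
Proof.
move=> n0 /andP[x0 x1] rx1 rxr t0 MM dev.
have r0 : (0 < r)%N.
  by case: r rx1 {rxr M MM dev} => [|//]; rewrite mul0r ler10.
have r0' : 0 < r%:R :> R by rewrite ltr0n.
have n0' : 0 < n%:R :> R by rewrite ltr0n.
have m0 : 0 < (r * n)%:R :> R by rewrite natrM mulr_gt0.
have xN0 : x != 0.
  by apply: contraTneq rx1 => ->; rewrite mulr0 ler10.
have weightE k : (k <= r * n)%N -> (crossing_weight k M)%:R =
    k%:R - r%:R * #|inside_edges M (segment (r * n) k)|%:R :> R.
  move=> km.
  have := congr1 (fun i : nat => i%:R : R) (crossing_weight_inside r n k M MM km).
  by rewrite /= natrD natrM => <-; rewrite addrK.
rewrite ler_norml; apply/andP; split.
  (* Lower bound: test the maximiser [x * (r * n)] rounded down. It is at least 1 because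
     [r * x >= 1], and the rounding costs the final [+ 1]. *)
  pose k := Num.truncn (x * (r * n)%:R).
  have /truncn_itv/andP[kx xk] : 0 <= x * (r * n)%:R by rewrite mulr_ge0 ?ler0n.
  rewrite -/k -natr1 in kx xk.
  have k1 : (1 <= k)%N.
    rewrite /k truncn_gt0 natrM mulrA [x * _]mulrC.
    by rewrite -[leLHS]mulr1 ler_pM ?ler01 // ler1n.
  have km : (k <= r * n)%N.
    rewrite -(ler_nat R); apply: le_trans kx _.
    by rewrite ler_piMl // ltW.
  have krange : (1 <= k < (r * n).+1)%N by rewrite k1 ltnS.
  have : (crossing_weight k M <= max_crossing_weight M)%N.
    by apply: leq_bigmax_seq => //; rewrite mem_index_iota.
  rewrite -(ler_nat R) weightE //.
  have := dev k krange; rewrite ler_norml => /andP[_].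
  set N : R := #|_|%:R; set Y : R := (max_crossing_weight M)%:R.
  have yr : (k%:R / (r * n)%:R) ^+ r <= x ^+ r :> R.
    rewrite lerXn2r ?nnegrE ?divr_ge0 ?ler0n //.
    by rewrite ler_pdivrMr.
  move=> Nt; have : r%:R * N <= r%:R * (n%:R * x ^+ r + t).
    rewrite ler_wpM2l ?ler0n //.
    have := ler_wpM2l (ltW n0') yr; lra.
  rewrite mulrDr mulrCA rxr => rN kN.
  rewrite natrM in xk.
  lra.
suff : (max_crossing_weight M)%:R <= (r%:R - 1) * n%:R * x + r%:R * t.
  by move: (_ * x) => z; lra.
(* The iterated maximum starts from 0, so the bound must be nonnegative as well. *)
have B0 : 0 <= (r%:R - 1) * n%:R * x + r%:R * t.
  have r1 : 0 <= r%:R - 1 :> R by rewrite subr_ge0 ler1n.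
  by rewrite addr_ge0 ?mulr_ge0 // ltW.
rewrite /max_crossing_weight big_seq; elim/big_ind: _ => //.
  by move=> a b ha hb; case: (leqP a b).
move=> k; rewrite mem_index_iota => krange; have km : (k <= r * n)%N by lia.
rewrite weightE //; have := dev k krange; rewrite ler_norml => /andP[+ _].
set N : R := #|_|%:R; set y : R := k%:R / _.
have y0 : 0 <= y by rewrite divr_ge0 ?ler0n.
have kE : k%:R = r%:R * n%:R * y by rewrite -natrM mulrC divfK // gt_eqF.
(* The tangent to the [r]-th power at [x] has slope 1, hence [y - y ^+ r <= x - x ^+ r] for every
   [y >= 0]. *)
have := @exprS_ge_tangent R x y r.-1 x0 y0; rewrite prednK //.
have -> : r%:R * x ^+ r.-1 = 1.
  by apply: (mulIf xN0); rewrite -mulrA -exprSr prednK // rxr mul1r.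
move=> tangent devk; rewrite kE.
have h1 : r%:R * n%:R * (x ^+ r + 1 * (y - x)) <= r%:R * n%:R * y ^+ r.
  by rewrite ler_wpM2l // mulr_ge0 ?ler0n.
have h2 : r%:R * (n%:R * y ^+ r - t) <= r%:R * N.
  by rewrite ler_wpM2l ?ler0n //; lra.
have h3 : r%:R * n%:R * x ^+ r = n%:R * x by rewrite mulrAC rxr mulrC.
by lra.
Qed.

(** * Union bound over k *)

Lemma card_union_bound (T : finType) (I : eqType) (s : seq I) (A : {set T})
    (P : pred T) (B : I -> pred T) :
  {in A, forall x, (forall i, i \in s -> ~~ B i x) -> P x} ->
  (#|A| <= #|[set x in A | P x]| + \sum_(i <- s) #|[set x in A | B i x]|)%N.
Proof.
move=> AP.
have cardE (Q : pred T) : #|[set x in A | Q x]| = (\sum_(x in A) Q x)%N.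
  by rewrite -sum1dep_card big_mkcondr; apply: eq_bigr => x _; case: (Q x).
rewrite cardE (eq_bigr (fun i => \sum_(x in A) B i x)%N) => [|i _]; last first.
  exact: cardE.
rewrite exchange_big -big_split -sum1_card /=; apply: leq_sum => x xA.
have [//|nP] := boolP (P x).
have [/hasP[i si Bx]|/hasPn nB] := boolP (has (B^~ x) s).
  by rewrite (big_rem i) //= Bx.
by rewrite AP in nP.
Qed.

Lemma uniform_pr_le1 (R : realFieldType) (T : finType) (A : {set T}) (E : pred T) :
  uniform_pr R A E <= 1.
Proof.
rewrite /uniform_pr; have [->|A0] := posnP #|A|; first by rewrite invr0 mulr0.
rewrite ler_pdivrMr ?ltr0n // mul1r ler_nat; apply/subset_leq_card.
by apply/subsetP => x; rewrite inE => /andP[].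
Qed.

(** With [m = r * n], there are [m] values of [k], each failing with probability at most
    [m.+1 * (2 * E)], and [m.+1 <= 2 * m]; this yields the factor [4 * m ^ 2]. *)
Lemma max_crossing_weight_uniform_pr_ge (R : realType) (r n : nat) (x l t : R) :
  (0 < r)%N -> (0 < n)%N ->
  0 <= x <= 1 -> 1 <= r%:R * x -> r%:R * x ^+ r = x ->
  0 <= l <= 1 / 2 -> 0 <= t ->
  1 - 4 * r%:R ^+ 2 * n%:R ^+ 2 * expR (2 * l ^+ 2 * n%:R - l * t) <=
  uniform_pr R (matchings r n) (fun M =>
    `|(max_crossing_weight M)%:R - (r%:R - 1) * n%:R * x| <= r%:R * t + 1).
Proof.
move=> r0 n0 x01 rx1 rxr l01 t0; set E := expR _.
set P := fun M => _; have m0 : (0 < r * n)%N by rewrite muln_gt0 r0.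
have A0 : 0 < #|matchings r n|%:R :> R by rewrite ltr0n matchings_gt0.
rewrite /uniform_pr ler_pdivlMr // mulrBl mul1r lerBlDr.
pose B k (M : {set {set 'I_(r * n)}}) :=
  t < `|#|inside_edges M (segment (r * n) k)|%:R
        - n%:R * (k%:R / (r * n)%:R) ^+ r|.
have := @card_union_bound _ _ (index_iota 1 (r * n).+1) (matchings r n) P B.
rewrite -(ler_nat R) => /(_ _)/le_trans; apply.
  move=> M MM good; apply: max_crossing_weight_near => // k krange.
  by rewrite leNgt; apply: good; rewrite mem_index_iota.
rewrite natrD lerD2l natr_sum.
apply: (@le_trans _ _ (\sum_(1 <= k < (r * n).+1)
   #|matchings r n|%:R * ((r * n).+1%:R * (2 * E)) : R)).
  rewrite big_seq [leRHS]big_seq; apply: ler_sum => k.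
  rewrite mem_index_iota => /andP[k1 km].
  by apply: matchings_tail.
rewrite sumr_const_nat subn1 /= -[leLHS]mulr_natr -mulrA [leRHS]mulrC.
rewrite ler_wpM2l ?ler0n //.
have : (r * n).+1%:R <= 2 * (r%:R * n%:R) :> R.
  by rewrite -!natrM ler_nat; lia.
have E0 : 0 <= E by apply: expR_ge0.
move=> h; rewrite natrM.
apply: (@le_trans _ _ (2 * (r%:R * n%:R) * (2 * E) * (r%:R * n%:R))).
  by rewrite ler_wpM2r ?mulr_ge0 ?ler0n // ler_wpM2r // mulr_ge0.
by rewrite le_eqVlt; apply/orP; left; apply/eqP; ring.
Qed.

(** * The maximiser and logarithmic estimates *)

(** This [x] solves the critical equation [r * x ^+ r.-1 = 1] of [y - y ^+ r]. Since [x <= 1] and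
    [r.-1 >= 1], also [x ^+ r.-1 <= x], whence [1 <= r * x]. *)
Lemma crossing_profile_argmax (R : realType) (r : nat) : (2 <= r)%N ->
  let x : R := (r%:R `^ (1 / (r%:R - 1)))^-1 in
  [/\ 0 <= x <= 1, 1 <= r%:R * x & r%:R * x ^+ r = x].
Proof.
move=> r2 x; have r1 : 1 <= r%:R :> R by rewrite ler1n; lia.
have r0 : 0 < r%:R :> R by apply: lt_le_trans r1.
have rN : r%:R - 1 = r.-1%:R :> R by rewrite -subn1 natrB //; lia.
have rN0 : 0 < r.-1%:R :> R by rewrite ltr0n; lia.
have a1 : 1 <= r%:R `^ (1 / (r%:R - 1)) :> R.
  rewrite -[leLHS](powRr0 r%:R) ler_powR // rN divr_ge0 // ltW.
have a0 := lt_le_trans ltr01 a1.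
have xr : r%:R * x ^+ r.-1 = 1.
  rewrite /x exprVn -powR_mulrn ?ltW // -powRrM rN div1r mulVf ?gt_eqF //.
  by rewrite powRr1 ?ltW // mulfV // gt_eqF.
have x0 : 0 <= x by rewrite invr_ge0 ltW.
have x1 : x <= 1 by rewrite invf_le1.
split; first by rewrite x0.
  rewrite -[leLHS]xr ler_wpM2l ?(ltW r0) //.
  have -> : r.-1 = r.-2.+1 by lia.
  by rewrite exprS ler_piMr // exprn_ile1.
by rewrite -[in x ^+ r](@prednK r) ?exprSr ?mulrA ?xr ?mul1r //; lia.
Qed.

Lemma ln_le_2sqrt (R : realType) (x : R) : 0 < x -> ln x <= 2 * Num.sqrt x.
Proof.
move=> x0; have s0 : 0 < Num.sqrt x by rewrite sqrtr_gt0.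
rewrite -{1}[x]sqr_sqrtr ?(ltW x0) // lnXn // -[leLHS]mulr_natl ler_wpM2l //.
have := @le_ln1Dx R (Num.sqrt x - 1); rewrite subrKC => h.
by apply: le_trans (h _) _; lra.
Qed.

(** The threshold is [32 ^ 2], so that [16 * ln n <= 32 * sqrt n <= n]. The first bound keeps the
    Chernoff parameter below one half, the second lets the rounding error be absorbed. *)
Lemma ln_nat_bounds (R : realType) (n : nat) : (1024 <= n)%N ->
  16 * ln n%:R <= n%:R :> R /\ 1 <= n%:R * ln n%:R :> R.
Proof.
move=> n1024; have n0 : 0 < n%:R :> R by rewrite ltr0n; lia.
have nR : 1024 <= n%:R :> R by rewrite ler_nat.
split.
  have := ln_le_2sqrt R n%:R n0; have := sqr_sqrtr (ltW n0).
  have : 32 <= Num.sqrt (n%:R : R).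
    have -> : 32 = Num.sqrt (1024 : R).
      by rewrite (_ : 1024 = 32 ^+ 2 :> R) ?sqrtr_sqr ?ger0_norm // -natrX.
    by rewrite ler_wsqrtr.
  set s := Num.sqrt _; rewrite expr2 => s32 ss lns.
  have := ler_wpM2r (_ : 0 <= s) s32; rewrite ss => /(_ ltac:(lra)); lra.
have half : 1 / 2 <= ln (n%:R : R).
  rewrite -ler_expR lnK ?posrE //; apply: le_trans (expR_le_1D R (1/2) _) _; lra.
nra.
Qed.

(** * Choice of parameters and passage to the limit *)

Local Open Scope classical_set_scope.

Theorem theorem1p4 (R : realType) (r : nat) (hr : (2 <= r)%N) :
  exists C : R, 0 < C /\
    (fun n : nat =>
       uniform_pr R (matchings r n)
         (fun M => `| (max_crossing_weight M)%:R
                      - (r%:R - 1) * n%:R / (r%:R `^ (1 / (r%:R - 1))) |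
                   <= C * Num.sqrt (n%:R * ln n%:R)))
      @ \oo --> (1 : R).
Proof.
have [x01 rx1 rxr] := crossing_profile_argmax R r hr; set x := _^-1 in x01 rx1 rxr.
(* The deviation is [t = 8 * s] with [s = sqrt (n * ln n)]; the error [r * t + 1] is at most
   [(8 * r + 1) * s] once [s >= 1]. *)
exists (8 * r%:R + 1); split; first by rewrite ltr_wpDl ?mulr_ge0 ?ler0n.
apply: (@squeeze_cvgr _ _ _ _ (fun n => 1 - 8 * r%:R ^+ 2 * @harmonic R n) (cst 1));
  [|rewrite -[X in _ --> X](_ : 1 - 8 * r%:R ^+ 2 * 0 = 1)|exact: cvg_cst]; last 2 first.
- apply: cvgB; first exact: cvg_cst.
  by apply: cvgMr; exact: cvg_harmonic.
- by rewrite mulr0 subr0.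
near=> n; apply/andP; split; last exact: uniform_pr_le1.
have n1024 : (1024 <= n)%N by near: n; exact: nbhs_infty_ge.
have [L16 nL1] := ln_nat_bounds R n n1024.
set L := ln n%:R in L16 nL1 *.
have nR : 1024 <= n%:R :> R by rewrite ler_nat.
have n0 : 0 < n%:R :> R by lra.
have s2 : Num.sqrt (n%:R * L) ^+ 2 = n%:R * L by rewrite sqr_sqrtr //; lra.
set s := Num.sqrt _ in s2 *.
have s1 : 1 <= s by rewrite -[leLHS]sqrtr1 ler_wsqrtr.
have s4n : 4 * s <= n%:R.
  rewrite -(@ler_pXn2r _ 2) ?nnegrE ?mulr_ge0 //; try lra.
  by rewrite exprMn s2 expr2; have := ler_wpM2l (ltW n0) L16; lra.
(* The minimiser [t / (4 * n)] of [2 * l ^+ 2 * n - l * t] at [t = 8 * s]; the exponent becomes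
   [- 8 * ln n]. *)
pose l := 2 * s / n%:R.
have l01 : 0 <= l <= 1 / 2.
  rewrite /l divr_ge0 /= ?mulr_ge0 ?ler_pdivrMr //; lra.
have rn : (0 < r)%N := ltnW hr.
have nn : (0 < n)%N := leq_trans (ltn0Sn _) n1024.
have t0 : 0 <= 8 * s by lra.
have := max_crossing_weight_uniform_pr_ge R r n x l (8 * s) rn nn x01 rx1 rxr l01 t0.
have -> : 2 * l ^+ 2 * n%:R - l * (8 * s) = - (8%:R * L).
  transitivity (- 8 * s ^+ 2 / n%:R); first by rewrite /l; field; rewrite gt_eqF.
  by rewrite s2; field; rewrite gt_eqF.
rewrite expRN expRM_natl lnK ?posrE // => h.
(* The failure bound [4 * r ^ 2 * n ^ 2 / n ^ 8] is relaxed to [4 * r ^ 2 / n], then compared with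
   [harmonic n = 1 / (n + 1)] through [1 / n <= 2 / (n + 1)]. *)
have step : 1 - 8 * r%:R ^+ 2 * @harmonic R n <=
    1 - 4 * r%:R ^+ 2 * n%:R ^+ 2 * (n%:R ^+ 8)^-1.
  rewrite lerD2l lerN2.
  have e8 : (n%:R ^+ 8)^-1 <= (n%:R ^+ 3)^-1 :> R.
    rewrite lef_pV2 ?posrE ?exprn_gt0 // ler_weXn2l //; lra.
  apply: (@le_trans _ _ (4 * r%:R ^+ 2 * n%:R ^+ 2 * (n%:R ^+ 3)^-1)).
    by rewrite ler_wpM2l // !mulr_ge0 ?exprn_ge0 ?ler0n.
  have -> : 4 * r%:R ^+ 2 * n%:R ^+ 2 * (n%:R ^+ 3)^-1 =
      4 * r%:R ^+ 2 * n%:R^-1 :> R.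
    by field; rewrite gt_eqF.
  have hn : n%:R^-1 <= 2 * @harmonic R n.
    rewrite /harmonic /= -[leLHS]mul1r ler_pdivrMr // mulrAC.
    by rewrite ler_pdivlMr ?ltr0n // -natr1; lra.
  by have := ler_wpM2l (sqr_ge0 r%:R) hn; lra.
apply: le_trans step _; apply: le_trans h _.
rewrite /uniform_pr ler_wpM2r ?invr_ge0 ?ler0n // ler_nat.
apply/subset_leq_card/subsetP => M; rewrite !inE => /andP[-> /=].
by move/le_trans; apply; lra.
Unshelve. all: by end_near.
Qed.
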